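(* Let $n\ge 2$, let $G$ be any finite group, let $W_n=G\wr S_n$, and let $\Gamma=([n],c)$ be a weighted hypergraph with non-negative weights $c_B\ge 0$ ($B\subseteq[n]$). Then $$\lambda_{\min}^*\left(\Gamma,\mathrm{Reg}_{W_n}\right)=\lambda_{\min}^*\left(\Gamma,\mathrm{Reg}_{S_n}\right).$$
   Context: Notation: $[n]=\{1,\dots,n\}$; $e$ is the unit of a group. A weighted hypergraph $\Gamma=([n],c)$ is an assignment of a weight $c_B\in\mathbb{R}_{\ge 0}$ to every subset $B\subseteq[n]$. $W_n=G\wr S_n=G^n\rtimes S_n$ has elements $(\mathbf g;\sigma)$ with $\mathbf g=(g_1,\dots,g_n)\in G^n$, $\sigma\in S_n$, and multiplication $(g_1,\dots,g_n;\sigma)(h_1,\dots,h_n;\tau)=(g_1h_{\sigma^{-1}(1)},\dots,g_nh_{\sigma^{-1}(n)};\sigma\tau)$. For $B\subseteq[n]$: $S_B=\{\sigma\in S_n:\sigma(i)=i\ \forall i\notin B\}$, and $W_B=\{(\mathbf g;\sigma)\in W_n:\sigma\in S_B,\ g_i=e_G\ \forall i\notin B\}$. Put $$J_B=\frac1{|S_B|}\sum_{\pi\in S_B}\pi\in\mathbb{C}[S_n],\qquad J_B^{(G)}=\frac1{|W_B|}\sum_{w\in W_B}w\in\mathbb{C}[W_n],$$ $$\mathcal L_\Gamma=\sum_{B\subseteq[n]}c_B(e-J_B)\in\mathbb{C}[S_n],\qquad \mathcal L_\Gamma^{(G)}=\sum_{B\subseteq[n]}c_B(e-J_B^{(G)})\in\mathbb{C}[W_n].$$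 Let $\phi$ be a finite-dimensional complex representation of $S_n$ (resp. $W_n$), extended linearly to the group algebra. The eigenvalues of $\phi(\mathcal L_\Gamma)$ (resp. $\phi(\mathcal L^{(G)}_\Gamma)$) are real and non-negative. Write $\phi\cong\phi'\oplus k\cdot\mathrm{triv}$ with $k\ge0$ and $\phi'$ having no trivial component. Then $\lambda_{\min}^*(\Gamma,\phi)$ denotes the smallest eigenvalue of $\phi'(\mathcal L_\Gamma)$ (resp. of $\phi'(\mathcal L_\Gamma^{(G)})$), and is $\infty$ if $\phi'=0$. $\mathrm{Reg}_{S_n}$ and $\mathrm{Reg}_{W_n}$ are the left-regular representations on $\mathbb{C}[S_n]$ and $\mathbb{C}[W_n]$. *)

(* Defs.v *)
From HB Require Import structures.
From mathcomp Require Import all_boot all_order all_algebra all_fingroup.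
From mathcomp Require Import pgroup mxrepresentation character.
From mathcomp Require Import boolp classical_sets reals constructive_ereal ereal.
From mathcomp Require Import complex.

Set Implicit Arguments.
Unset Strict Implicit.
Unset Printing Implicit Defensive.

Import Order.TTheory GRing.Theory Num.Theory.
Local Open Scope ring_scope.
Local Open Scope complex_scope.

(* The product of {perm 'I_n} in fingroup/perm is (s * t) i = t (s i).  The
   semidirect product below needs (s * t) i = s (t i), so the symmetric group
   is re-packaged with that product. *)
Record symg (n : nat) := Symg { perm_of_symg :> {perm 'I_n} }.

HB.instance Definition _ n := [isNew for @perm_of_symg n].
HB.instance Definition _ n := [Finite of symg n by <:].

Section SymmetricGroup.
Variable n : nat.
Implicit Types s t u : symg n.

Definition symg_one : symg n := Symg 1%g.
Definition symg_mul s t : symg n := Symg (perm_of_symg t * perm_of_symg s)%g.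
Definition symg_inv s : symg n := Symg (perm_of_symg s)^-1%g.

Lemma symg_mulA : associative symg_mul.
Proof. by move=> s t u; apply: val_inj; rewrite /= mulgA. Qed.

Lemma symg_mul1 : left_id symg_one symg_mul.
Proof. by move=> s; apply: val_inj; rewrite /= mulg1. Qed.

Lemma symg_mulV : left_inverse symg_one symg_inv symg_mul.
Proof. by move=> s; apply: val_inj; rewrite /= mulgV. Qed.

HB.instance Definition _ :=
  Finite_isGroup.Build (symg n) symg_mulA symg_mul1 symg_mulV.

Lemma symgME s t i : (s * t)%g i = s (t i).
Proof. by rewrite /= permM. Qed.

End SymmetricGroup.

Record wreath (n : nat) (gT : finGroupType) :=
  Wreath { wbase : {ffun 'I_n -> gT}; wperm : symg n }.

Section WreathProduct.
Variables (n : nat) (gT : finGroupType).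

Definition pair_of_wreath (w : wreath n gT) := (wbase w, wperm w).
Definition wreath_of_pair (p : {ffun 'I_n -> gT} * symg n) := Wreath p.1 p.2.

Lemma pair_of_wreathK : cancel pair_of_wreath wreath_of_pair.
Proof. by case. Qed.

HB.instance Definition _ := Finite.copy (wreath n gT) (can_type pair_of_wreathK).

Implicit Types v w : wreath n gT.

Definition wreath_one : wreath n gT := Wreath [ffun => 1%g] 1%g.
Definition wreath_mul v w : wreath n gT :=
  Wreath [ffun i => (wbase v i * wbase w ((wperm v)^-1%g i))%g]
         (wperm v * wperm w)%g.
Definition wreath_inv w : wreath n gT :=
  Wreath [ffun i => (wbase w (wperm w i))^-1%g] (wperm w)^-1%g.

Lemma wreath_mulA : associative wreath_mul.
Proof.
move=> u v w; rewrite /wreath_mul /= mulgA; congr Wreath.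
by apply/ffunP=> i; rewrite !ffunE mulgA invMg permM.
Qed.

Lemma wreath_mul1 : left_id wreath_one wreath_mul.
Proof.
case=> g s; rewrite /wreath_mul /= mul1g; congr Wreath.
by apply/ffunP=> i; rewrite !ffunE mul1g invg1 perm1.
Qed.

Lemma wreath_mulV : left_inverse wreath_one wreath_inv wreath_mul.
Proof.
case=> g s; rewrite /wreath_mul /wreath_one /= mulVg; congr Wreath.
by apply/ffunP=> i; rewrite !ffunE invgK mulVg.
Qed.

HB.instance Definition _ :=
  Finite_isGroup.Build (wreath n gT) wreath_mulA wreath_mul1 wreath_mulV.

End WreathProduct.

Definition symg_sub n (B : {set 'I_n}) : {set symg n} :=
  [set s : symg n | [forall i, (i \notin B) ==> (s i == i)]].

Definition wreath_sub n (gT : finGroupType) (B : {set 'I_n}) :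
    {set wreath n gT} :=
  [set w : wreath n gT | (wperm w \in symg_sub B) &&
     [forall i, (i \notin B) ==> (wbase w i == 1%g)]].

Section Representations.
Variables (R : realType) (gT : finGroupType).

(* The underlying vector space of the group algebra C[gT]. *)
Definition galg := {ffun gT -> R[i]^o}.

Definition galg_elt (x : gT) : galg := [ffun y => (y == x)%:R].

Definition galg_avg (A : {set gT}) : galg :=
  (#|A|%:R : R[i])^-1 *: \sum_(x in A) galg_elt x.

Local Notation rep := (representation R[i] [set: gT]).

(* Matrices act on column vectors. *)
Definition repr_ext (phi : rep) (a : galg) : 'M[R[i]]_(rdegree phi) :=
  \sum_(x : gT) a x *: phi x.

Lemma triv_mx_repr : mx_repr [set: gT] (fun _ : gT => 1%:M : 'M[R[i]]_1).
Proof. by split=> // x y _ _; rewrite mulmx1. Qed.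

Definition triv_grepr : rep := Representation (MxRepresentation triv_mx_repr).

(* The j-th basis vector is the j-th element g_j of gT; x sends it to
   x * g_j. *)
Definition left_regular_mx (x : gT) : 'M[R[i]]_#|gT| :=
  \matrix_(i, j) (enum_val i == (x * enum_val j)%g)%:R.

Lemma left_regular_mx_repr : mx_repr [set: gT] left_regular_mx.
Proof.
split=> [|x y _ _]; apply/matrixP=> i j; rewrite !mxE.
  by rewrite mul1g (inj_eq enum_val_inj).
rewrite (bigD1 (enum_rank (y * enum_val j)%g)) //= !mxE enum_rankK eqxx mulr1.
rewrite mulgA big1 ?addr0 // => k; rewrite !mxE => nk.
by rewrite -(inj_eq enum_val_inj) enum_rankK in nk; rewrite (negPf nk) mulr0.
Qed.

Definition left_regular : rep :=
  Representation (MxRepresentation left_regular_mx_repr).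

Definition has_triv_component (phi : rep) : Prop :=
  exists psi : rep, mx_rsim phi (dadd_grepr triv_grepr psi).

Definition triv_split (phi phi' : rep) (k : nat) : Prop :=
  mx_rsim phi (dadd_grepr phi' (muln_grepr triv_grepr k)) /\
  ~ has_triv_component phi'.

(* A splitting exists (triv_split_exists) and any one of them gives the same
   set (lambda_min_starE), namely the finite set of real eigenvalues of
   phi'(a); its infimum is the least of them, and +oo if phi' = 0. *)
Definition lambda_min_star (a : galg) (phi : rep) : \bar R :=
  ereal_inf [set r%:E | r in [set r : R |
    exists (phi' : rep) (k : nat),
      triv_split phi phi' k /\ eigenvalue (repr_ext phi' a) r%:C]]%classic.

Section TrivialSummand.
Implicit Types phi psi : rep.

Lemma repr_rsim_triv n1 n2 (rG1 : mx_representation R[i] [set: gT] n1)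
    (rG2 : mx_representation R[i] [set: gT] n2) :
  n1 = n2 -> (forall x, rG1 x = 1%:M) -> (forall x, rG2 x = 1%:M) ->
  mx_rsim rG1 rG2.
Proof.
move=> e; subst n2 => h1 h2; exists 1%:M => // [|x _].
  by rewrite row_free_unit unitmx1.
by rewrite h1 h2.
Qed.

Lemma muln_triv1 k x : muln_grepr triv_grepr k x = 1%:M.
Proof.
move: x; apply: (big_ind (fun r : rep => forall x, r x = 1%:M)) => //= r1 r2.
by move=> h1 h2 x; rewrite h1 h2 -scalar_mx_block.
Qed.

Lemma rdegree_muln_triv k : rdegree (muln_grepr triv_grepr k) = k.
Proof.
by rewrite (big_morph (@rdegree _ _ _) (id1 := 0%N) (op1 := addn)) // sum1_card card_ord.
Qed.

Lemma submod_fixed n (rG : mx_representation R[i] [set: gT] n) (U : 'M_n)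
    (modU : mxmodule rG U) x :
  (U <= rfix_mx rG [set: gT])%MS -> submod_repr modU x = 1%:M.
Proof.
move=> /rfix_mxP fixU.
have fixv : val_submod (1%:M : 'M_(\rank U)) *m rG x = val_submod 1%:M.
  have /submxP[D ->] : (val_submod (1%:M : 'M_(\rank U)) <= U)%MS.
    exact: val_submodP.
  by rewrite -mulmxA fixU ?inE.
apply: (can_inj val_submodK).
by rewrite -[submod_repr modU x]mul1mx val_submodJ ?inE.
Qed.

Lemma group_Maschke n (rG : mx_representation R[i] [set: gT] n) :
  mx_completely_reducible rG 1%:M.
Proof.
apply: mx_Maschke_pchar; rewrite /pgroup pcharf'_nat pnatr_eq0 -lt0n.
by rewrite cardG_gt0.
Qed.

Lemma has_triv_componentP phi :
  has_triv_component phi <-> rfix_mx phi [set: gT] != 0.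
Proof.
split=> [[psi /mx_rsim_sym [B /= _ freeB homB]]|nz].
  pose v := (row_mx 1%:M 0 : 'M_(1, 1 + rdegree psi)) *m B.
  have: (v <= rfix_mx phi [set: gT])%MS.
    apply/rfix_mxP => x Gx; rewrite -mulmxA -homB // mulmxA mul_row_block.
    by rewrite !(mulmx0, mul0mx, mulmx1, addr0).
  apply: contraTneq => ->; rewrite submx0 -(mul0mx _ B).
  apply/eqP => /(row_free_inj freeB) /(congr1 lsubmx).
  by rewrite row_mxKl linear0 => /eqP; rewrite oner_eq0.
pose W := <<nz_row (rfix_mx phi [set: gT])>>%MS.
have sW : (W <= rfix_mx phi [set: gT])%MS by rewrite genmxE nz_row_sub.
have modW : mxmodule phi W.
  by apply/mxmoduleP => x Gx; move/rfix_mxP: sW => ->.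
have [U modU defU dxU] := group_Maschke modW (submx1 _).
have rW : \rank W = 1%N by rewrite genmxE rank_rV nz_row_eq0 nz.
exists (Representation (submod_repr modU)).
apply: mx_rsim_trans (mx_rsim_dadd (rU := triv_grepr)
  (rV := Representation (submod_repr modU)) (modU := modW)
  (mxmodule1 phi) defU dxU _ (mx_rsim_refl _)).
  by apply: mx_rsim_sym; apply: rsim_submod1.
by apply: (repr_rsim_triv rW) => // x; apply: submod_fixed.
Qed.

Lemma triv_split_exists phi : exists phi' k, triv_split phi phi' k.
Proof.
set W := rfix_mx phi [set: gT].
have modW : mxmodule phi W by apply: rfix_mx_module.
have [U modU defU dxU] := group_Maschke modW (submx1 _).
exists (Representation (submod_repr modU)), (\rank W); split.
  have defU' : (U + W :=: 1%:M)%MS by rewrite addsmxC.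
  have dxU' : mxdirect (U + W).
    by rewrite mxdirectE /= addsmxC addnC -mxdirectE.
  apply: mx_rsim_trans (mx_rsim_dadd (rV := muln_grepr triv_grepr (\rank W))
    (rU := Representation (submod_repr modU)) (modV := modW)
    (mxmodule1 phi) defU' dxU' (mx_rsim_refl _) _).
    by apply: mx_rsim_sym; apply: rsim_submod1.
  apply: repr_rsim_triv; first by rewrite rdegree_muln_triv.
    by move=> x; apply: submod_fixed.
  exact: muln_triv1.
move=> h; have := (has_triv_componentP _).1 h; apply/negP.
rewrite negbK -submx0 /=.
rewrite rfix_submod //= -/W capmxC (mxdirect_addsP dxU).
by rewrite in_submodE mul0mx sub0mx.
Qed.

Lemma triv_split_sum phi phi' k :
  triv_split phi phi' k -> \sum_(x : gT) phi' x = 0.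
Proof.
move=> [_ ntriv]; have /eqP fix0 : rfix_mx phi' [set: gT] == 0.
  by apply: contra_notT ntriv => /(has_triv_componentP _).2.
suff: ((\sum_(x : gT) phi' x)%R <= rfix_mx phi' [set: gT])%MS.
  by rewrite fix0 submx0 => /eqP.
apply/rfix_mxP => y _.
rewrite mulmx_suml (reindex_inj (mulIg y^-1%g)) /=.
by apply: eq_bigr => x _; rewrite -repr_mxM ?inE // mulgKV.
Qed.

Lemma triv_split_eigenvalue phi phi' k (a : galg) z : triv_split phi phi' k ->
  eigenvalue (repr_ext phi' a) z <->
  exists v : 'rV_(rdegree phi), [/\ v != 0, v *m repr_ext phi a = z *: v &
    v *m \sum_(x : gT) phi x = 0].
Proof.
move=> split_phi; have sum0 := triv_split_sum split_phi.
have [/mx_rsim_sym [B /= eqd freeB homB] _] := split_phi.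
set T := muln_grepr triv_grepr k in B eqd freeB homB.
have homE (b : gT -> R[i]) : B *m (\sum_x b x *: phi x) =
    block_mx (\sum_x b x *: phi' x) 0 0 (\sum_x b x *: T x) *m B.
  have -> : block_mx (\sum_x b x *: phi' x) 0 0 (\sum_x b x *: T x) =
      \sum_x b x *: block_mx (phi' x) 0 0 (T x).
    rewrite (eq_bigr (fun x => block_mx (b x *: phi' x) 0 0 (b x *: T x))).
      apply: (big_ind3 (fun X Y Z => block_mx X 0 0 Y = Z)) => //.
        by rewrite block_mx0.
      by move=> X1 Y1 Z1 X2 Y2 Z2 <- <-; rewrite add_block_mx !addr0.
    by move=> x _; rewrite scale_block_mx !scaler0.
  rewrite mulmx_sumr mulmx_suml; apply: eq_bigr => x _.
  by rewrite -scalemxAr -scalemxAl homB ?inE.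
have sumE : B *m (\sum_x phi x) = block_mx 0 0 0 #|gT|%:R%:M *m B.
  transitivity (B *m (\sum_x (1 : R[i]) *: phi x)).
    by congr (_ *m _); apply: eq_bigr => x _; rewrite scale1r.
  rewrite homE -[in RHS]sum0; congr (block_mx _ _ _ _ *m _).
    by apply: eq_bigr => x _; rewrite scale1r.
  rewrite (eq_bigr (fun=> 1%:M)) => [|x _]; last by rewrite scale1r muln_triv1.
  by rewrite sumr_const -scaler_nat scalemx1.
have injB m : injective (mulmx^~ B : 'M_(m, _) -> 'M_(m, _)).
  exact: row_free_inj.
have fullB : row_full B by apply/eqP; apply: etrans (eqP freeB) eqd.
split=> [/eigenvalueP[u uE u0]|[v [v0 vE vP]]].
  exists (row_mx u 0 *m B); split.
  - rewrite -(mul0mx _ B) (inj_eq (injB _)).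
    by apply: contraNneq u0 => /(congr1 lsubmx); rewrite row_mxKl linear0 => ->.
  - rewrite -mulmxA homE mulmxA mul_row_block -/(repr_ext phi' a) uE.
    by rewrite !(mulmx0, mul0mx, addr0) [in RHS]scalemxAl scale_row_mx scaler0.
  - rewrite -mulmxA sumE mulmxA mul_row_block !(mulmx0, mul0mx, addr0).
    by rewrite row_mx0 mul0mx.
have /submxP[w vw] : (v <= B)%MS by apply: submx_full.
rewrite vw -(hsubmxK w) in v0 vE vP.
move: v0 vE vP; set u := lsubmx w; set t := rsubmx w => v0 vE vP.
have t0 : t = 0.
  move: vP; rewrite -mulmxA sumE mulmxA mul_row_block !(mulmx0, addr0, add0r).
  rewrite -(mul0mx _ B) => /injB /(congr1 rsubmx); rewrite row_mxKr linear0.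
  rewrite mul_mx_scalar => /eqP; rewrite scaler_eq0 pnatr_eq0 => /orP[|/eqP//].
  by rewrite -cardsT => /eqP h; have := cardG_gt0 [set: gT]%G; rewrite /= h.
apply/eigenvalueP; exists u.
  move: vE; rewrite t0 -mulmxA homE mulmxA scalemxAl => /injB.
  rewrite mul_row_block scale_row_mx !(mulmx0, mul0mx, addr0, scaler0).
  by move=> /(congr1 lsubmx); rewrite !row_mxKl.
by apply: contraNneq v0 => ->; rewrite t0 row_mx0 mul0mx.
Qed.

Lemma lambda_min_starE (a : galg) phi phi' k : triv_split phi phi' k ->
  lambda_min_star a phi =
  ereal_inf [set r%:E | r in [set r : R |
    eigenvalue (repr_ext phi' a) r%:C]]%classic.
Proof.
move=> sp; rewrite /lambda_min_star; congr (ereal_inf (_ @` _)).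
apply/seteqP; split=> r /=; last by exists phi', k.
move=> [phi2 [k2 [sp2 /(triv_split_eigenvalue _ _ sp2) h]]].
exact/(triv_split_eigenvalue _ _ sp).
Qed.

End TrivialSummand.

End Representations.

Section Laplacians.
Variables (R : realType) (n : nat) (c : {set 'I_n} -> R).

Definition laplacian : galg R (symg n) :=
  \sum_(B : {set 'I_n})
    ((c B)%:C : R[i]) *: (galg_elt R 1%g - galg_avg R (symg_sub B)).

Definition wreath_laplacian (gT : finGroupType) : galg R (wreath n gT) :=
  \sum_(B : {set 'I_n})
    ((c B)%:C : R[i]) *: (galg_elt R 1%g - galg_avg R (wreath_sub gT B)).

End Laplacians.

(* Main.v *)
Require Import Defs.
From mathcomp Require Import all_boot all_order all_algebra all_fingroup.
From mathcomp Require Import spectral sesquilinear mxrepresentation character.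
From mathcomp Require Import boolp classical_sets reals constructive_ereal ereal.
From mathcomp Require Import complex.

Set Implicit Arguments.
Unset Strict Implicit.
Unset Printing Implicit Defensive.

Import Order.TTheory GRing.Theory Num.Theory.
Local Open Scope ring_scope.

(** Row vectors acted on by the left regular representation of a group are
    functions [F] on the group, and the term [J_B] of the Laplacian sends [F] to
    its average [g |-> avg (H B) F g] over left translations by the subgroup
    [H B].  So both sides of the theorem are infima over the real eigenvalues of
    the operator [lap] on nonzero functions of sum zero
    ([lambda_min_star_regularE]).

    A function on the symmetric group pulls back along the projection [wperm]
    of the wreath product, and the pullback intertwines the two Laplacians
    ([zero_sum_eigenfunction_wperm]).  Hence the spectrum of [S_n] is contained
    in that of [W_n], and it remains to bound below each eigenvalue [r] of
    [W_n].

    Let [F] be an eigenfunction for [r].  Average it over the [n] copies of [G],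
    one after the other.  These averages commute with the Laplacian, so they
    produce eigenfunctions as long as the result does not vanish
    ([wreath_eigenvalue_dichotomy]).  If it never vanishes, the last function is
    invariant under [G ^ n], is therefore pulled back from the symmetric group,
    and [r] is already an eigenvalue there.  Otherwise some eigenfunction for [r]
    has average zero over the [i]-th copy of [G].  All the averages with [i] in
    [B] then kill it, as these subgroups contain this copy, and every other term
    of the Laplacian is positive; so [r >= d_i], the total weight of the
    hyperedges containing [i] ([eigenvalue_ge_killed]).

    It remains to find an eigenvalue of the symmetric group that is at most
    [d_i] ([symg_small_eigenvalue]).  On the permutation representation on
    [{1, .., n}], the vector [u = e_i - 1/n] has
    [<u, L u> = \sum_(B contains i) c_B (1 - 1/|B|)] and [<u, u> = 1 - 1/n], so
    its Rayleigh quotient is at most [d_i], and the spectral theorem gives an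
    eigenvector of sum zero with an eigenvalue at most [d_i]. *)

(** * Averaging operators on functions over a finite group *)

Section Averaging.
Variables (C : numClosedFieldType) (gT : finGroupType).
Implicit Types (A B : {set gT}) (H K : {group gT}) (F : gT -> C).

Definition avg A F (g : gT) : C :=
  (#|A|%:R)^-1 * \sum_(x in A) F (x * g)%g.

Lemma card_group_neq0 H : (#|H|%:R : C) != 0.
Proof. by rewrite pnatr_eq0 -lt0n cardG_gt0. Qed.

Lemma avg_const A F g a :
  A != finset.set0 -> (forall x, x \in A -> F (x * g)%g = a) -> avg A F g = a.
Proof.
move=> nA h; rewrite /avg (eq_bigr (fun=> a)) // sumr_const -[a *+ _]mulr_natl mulKf //.
by rewrite pnatr_eq0 cards_eq0.
Qed.

Lemma avg_translate H F g y : y \in H -> avg H F (y * g)%g = avg H F g.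
Proof.
move=> Hy; rewrite /avg; congr (_ * _).
rewrite [RHS](reindex_inj (mulIg y)) /=.
by apply: eq_big => [x|x _]; rewrite ?groupMr ?mulgA.
Qed.

Lemma avg_absorbl H K F : K \subset H -> avg K (avg H F) = avg H F.
Proof.
move=> sKH; apply/funext => g; apply: avg_const.
  by rewrite -cards_eq0 -lt0n cardG_gt0.
by move=> x /(fintype.subsetP sKH) Hx; exact: avg_translate.
Qed.

Lemma avg_absorbr H K F : K \subset H -> avg H (avg K F) = avg H F.
Proof.
move=> sKH; apply/funext => g.
rewrite /avg -mulr_sumr exchange_big /=.
rewrite (eq_bigr (fun=> \sum_(x in H) F (x * g)%g)) => [|y Ky].
  by rewrite sumr_const -[(\sum_(_ in _) _) *+ _]mulr_natl mulKf ?card_group_neq0.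
have Hy := fintype.subsetP sKH y Ky.
rewrite [RHS](reindex_inj (mulgI y)) /=.
by apply: eq_big => [x|x _]; rewrite ?groupMl ?mulgA.
Qed.

Lemma avg_comm A B F :
  {in A & B, commutative (@mulg gT)} -> avg A (avg B F) = avg B (avg A F).
Proof.
move=> cAB; apply/funext => g.
rewrite /avg -!mulr_sumr mulrCA exchange_big /=; do 2!congr (_ * _).
apply: eq_bigr => y By; apply: eq_bigr => x Ax.
by rewrite !mulgA (cAB x y).
Qed.

Lemma avg0 A : avg A (fun=> 0) = fun=> 0.
Proof. by apply/funext => g; rewrite /avg big1 ?mulr0. Qed.

Lemma avgB A F1 F2 : avg A (fun g => F1 g - F2 g) = fun g => avg A F1 g - avg A F2 g.
Proof. by apply/funext => g; rewrite /avg sumrB mulrBr. Qed.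

Lemma avgZ A a F : avg A (fun g => a * F g) = fun g => a * avg A F g.
Proof. by apply/funext => g; rewrite /avg -mulr_sumr mulrCA. Qed.

Lemma avg_sum I (r : seq I) A (Fs : I -> gT -> C) :
  avg A (fun g => \sum_(i <- r) Fs i g) = fun g => \sum_(i <- r) avg A (Fs i) g.
Proof. by apply/funext => g; rewrite /avg exchange_big mulr_sumr. Qed.

Lemma sum_avg H F : \sum_g avg H F g = \sum_g F g.
Proof.
rewrite /avg -mulr_sumr exchange_big /=.
rewrite (eq_bigr (fun=> \sum_g F g)) => [|x _].
  by rewrite sumr_const -[(\sum_g _) *+ _]mulr_natl mulKf ?card_group_neq0.
by rewrite [RHS](reindex_inj (mulgI x)).
Qed.

Lemma avg_selfadjoint H F1 F2 :
  \sum_g (avg H F1 g)^* * F2 g = \sum_g (F1 g)^* * avg H F2 g.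
Proof.
transitivity (\sum_(x in H) \sum_g #|H|%:R^-1 * ((F1 g)^* * F2 (x^-1 * g)%g)).
  transitivity (\sum_(x in H) \sum_g #|H|%:R^-1 * ((F1 (x * g)%g)^* * F2 g)).
    rewrite exchange_big /=; apply: eq_bigr => g _.
    rewrite rmorphM rmorphV ?unitfE ?card_group_neq0 // rmorph_nat rmorph_sum.
    by rewrite -mulrA mulr_suml mulr_sumr.
  apply: eq_bigr => x _; rewrite [RHS](reindex_inj (mulgI x)).
  by apply: eq_bigr => g _; rewrite mulKg.
rewrite exchange_big /=; apply: eq_bigr => g _.
rewrite -!mulr_sumr mulrCA; do 2!congr (_ * _).
by rewrite (reindex_inj invg_inj); apply: eq_big => [x|x _]; rewrite ?groupV ?invgK.
Qed.

(** [avg H] is idempotent and self-adjoint, that is, an orthogonal projection;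
    the form below is therefore the squared norm of [F - avg H F]. *)
Lemma avg_compl_ge0 H F : 0 <= \sum_g (F g)^* * (F g - avg H F g).
Proof.
have orth : \sum_g (avg H F g)^* * (F g - avg H F g) = 0.
  rewrite avg_selfadjoint avgB avg_absorbl // big1 // => g _.
  by rewrite subrr mulr0.
have -> : \sum_g (F g)^* * (F g - avg H F g) =
    \sum_g (F g - avg H F g) * (F g - avg H F g)^*.
  rewrite -[LHS]subr0 -[X in _ - X = _]orth -sumrB; apply: eq_bigr => g _.
  by rewrite -mulrBl -rmorphB mulrC.
by apply: sumr_ge0 => g _; apply: mul_conjC_ge0.
Qed.

End Averaging.

(** * Laplacians of families of subgroups *)

Section Laplacian.
Variables (C : numClosedFieldType) (gT : finGroupType) (I : finType).
Variables (H : I -> {set gT}) (c : I -> C).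
Implicit Types F : gT -> C.

(** The transpose of left multiplication by [\sum_B c_B (e - J_B)] on the group
    algebra, where [J_B] is the mean of [H B]. *)
Definition lap F (g : gT) : C := \sum_B c B * (F g - avg (H B) F g).

Definition zero_sum_eigenfunction (r : C) F :=
  [/\ exists g, F g != 0, \sum_g F g = 0 & forall g, lap F g = r * F g].

Lemma avg_lap A F : (forall B, avg A (avg (H B) F) = avg (H B) (avg A F)) ->
  avg A (lap F) = lap (avg A F).
Proof.
move=> comm; rewrite /lap avg_sum; apply/funext => g; apply: eq_bigr => B _.
by rewrite avgZ avgB comm.
Qed.

Lemma zero_sum_eigenfunction_avg (K : {group gT}) r F :
    (forall B, avg K (avg (H B) F) = avg (H B) (avg K F)) ->
    (exists g, avg K F g != 0) ->
  zero_sum_eigenfunction r F -> zero_sum_eigenfunction r (avg K F).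
Proof.
move=> comm nz [_ sF eF]; split=> //; first by rewrite sum_avg.
move=> g; rewrite -avg_lap //; have -> : lap F = fun g => r * F g by apply/funext.
by rewrite avgZ.
Qed.

End Laplacian.

(** Pair the eigenvalue equation with [F].  A term that kills [F] under averaging
    contributes its full weight times the squared norm of [F], and every other
    term contributes a nonnegative number. *)
Lemma eigenvalue_ge_killed (C : numClosedFieldType) (gT : finGroupType)
    (I : finType) (H : I -> {group gT}) (c : I -> C) (S : pred I) r F :
    (forall B, 0 <= c B) -> (forall B, S B -> avg (H B) F = fun=> 0) ->
  zero_sum_eigenfunction H c r F -> \sum_(B | S B) c B <= r.
Proof.
move=> c0 killed [[g0 Fg0] _ eF].
set N := \sum_g (F g)^* * F g.
have N0 : 0 < N.
  rewrite /N (bigD1 g0) //= ltr_wpDr //.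
    by rewrite sumr_ge0 // => g _; rewrite mulrC mul_conjC_ge0.
  by rewrite mulrC mul_conjC_gt0.
rewrite -(ler_pM2r N0).
have -> : r * N = \sum_B c B * \sum_g (F g)^* * (F g - avg (H B) F g).
  rewrite /N mulr_sumr.
  rewrite (eq_bigr (fun g => \sum_B c B * ((F g)^* * (F g - avg (H B) F g)))).
    by rewrite exchange_big; apply: eq_bigr => B _; rewrite mulr_sumr.
  move=> g _; rewrite mulrCA -eF /lap mulr_sumr.
  by apply: eq_bigr => B _; rewrite mulrCA.
rewrite [leRHS](bigID S) /= ler_wpDr ?sumr_ge0 // => [B _|].
  by rewrite mulr_ge0 ?avg_compl_ge0.
rewrite mulr_suml ler_sum // => B SB; rewrite killed //.
by rewrite (eq_bigr (fun g => (F g)^* * F g)) // => g _; rewrite subr0.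
Qed.

(** * The spectrum of the left regular representation *)

Section RegularSpectrum.
Variables (R : realType) (gT : finGroupType).
Local Notation C := R[i].
Local Open Scope complex_scope.

Lemma mul_repr_ext_left_regular (a : galg R gT) (F : gT -> C) j :
  ((\row_k F (enum_val k)) *m repr_ext (left_regular R gT) a) 0 j =
  \sum_x a x * F (x * enum_val j)%g.
Proof.
rewrite /repr_ext mulmx_sumr summxE; apply: eq_bigr => x _.
rewrite -scalemxAr mxE; congr (_ * _).
rewrite mxE (bigD1 (enum_rank (x * enum_val j)%g)) //= !mxE enum_rankK eqxx.
rewrite mulr1 big1 ?addr0 // => k nk; rewrite !mxE.
by rewrite -(inj_eq enum_val_inj) enum_rankK in nk; rewrite (negPf nk) mulr0.
Qed.

Variables (I : finType) (H : I -> {set gT}) (c : I -> R).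

Definition galg_laplacian : galg R gT :=
  \sum_B ((c B)%:C : C) *: (galg_elt R 1%g - galg_avg R (H B)).

Lemma galg_laplacian_act (F : gT -> C) g :
  \sum_x galg_laplacian x * F (x * g)%g = lap H (fun B => (c B)%:C) F g.
Proof.
have elt_act (a : gT) : \sum_x galg_elt R a x * F (x * g)%g = F (a * g)%g.
  rewrite (bigD1 a) //= ffunE eqxx mul1r big1 ?addr0 // => x /negPf xa.
  by rewrite ffunE xa mul0r.
under eq_bigr do rewrite /galg_laplacian sum_ffunE mulr_suml.
rewrite exchange_big /=; apply: eq_bigr => B _.
transitivity ((c B)%:C * (\sum_x (galg_elt R 1%g x - galg_avg R (H B) x) * F (x * g)%g)).
  by rewrite mulr_sumr; apply: eq_bigr => x _; rewrite !ffunE mulrA.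
congr (_ * _); under eq_bigr do rewrite mulrBl.
rewrite sumrB elt_act mul1g; congr (_ - _).
rewrite /avg /galg_avg.
transitivity (\sum_x \sum_(y in H B) #|H B|%:R^-1 * (galg_elt R y x * F (x * g)%g)).
  apply: eq_bigr => x _; rewrite ffunE sum_ffunE -mulr_sumr -mulr_suml.
  by rewrite mulrA.
rewrite exchange_big mulr_sumr /=; apply: eq_bigr => y _.
by rewrite -mulr_sumr elt_act.
Qed.

(** The part without trivial component is the kernel of the sum of all group
    elements, which replaces each value of a function by the sum of its values;
    so this part consists of the functions of sum zero. *)
Lemma lambda_min_star_regularE :
  lambda_min_star galg_laplacian (left_regular R gT) =
  ereal_inf [set r%:E | r in [set r : R |
    exists F, zero_sum_eigenfunction H (fun B => (c B)%:C) r%:C F]]%classic.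
Proof.
have [phi' [k sp]] := triv_split_exists (left_regular R gT).
rewrite (lambda_min_starE _ sp); congr (ereal_inf (_ @` _)).
have sumE (F : gT -> C) j :
    ((\row_k F (enum_val k)) *m (\sum_x left_regular R gT x)) 0 j = \sum_x F x.
  rewrite [RHS](reindex_inj (mulIg (enum_val j))) /=.
  transitivity (((\row_k F (enum_val k)) *m
      repr_ext (left_regular R gT) [ffun=> 1]) 0 j).
    by congr ((_ *m _) 0 j); apply: eq_bigr => x _; rewrite ffunE scale1r.
  rewrite mul_repr_ext_left_regular.
  by apply: eq_bigr => x _; rewrite ffunE mul1r.
have lapE (F : gT -> C) j :
    ((\row_k F (enum_val k)) *m repr_ext (left_regular R gT) galg_laplacian) 0 j =
    lap H (fun B => (c B)%:C) F (enum_val j).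
  by rewrite mul_repr_ext_left_regular galg_laplacian_act.
apply/seteqP; split=> r /=.
  move=> /(triv_split_eigenvalue _ _ sp)[v [v0 vE vS]].
  pose F g := v 0 (enum_rank g).
  have vF : v = \row_k F (enum_val k).
    by apply/rowP => j; rewrite mxE /F enum_valK.
  rewrite vF in v0 vE vS; exists F; split.
  - have /rV0Pn [j] := v0; rewrite mxE => Fj.
    by exists (enum_val j).
  - by rewrite -(sumE F (enum_rank 1%g)) vS mxE.
  - by move=> g; rewrite -(enum_rankK g) -lapE vE !mxE.
move=> [F [[g Fg] FS FE]]; apply/(triv_split_eigenvalue _ _ sp).
exists (\row_k F (enum_val k)); split.
- by apply/rV0Pn; exists (enum_rank g); rewrite mxE enum_rankK.
- by apply/rowP => j; rewrite lapE FE !mxE.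
- by apply/rowP => j; rewrite sumE FS mxE.
Qed.

End RegularSpectrum.

(** * Rayleigh quotients *)

Section Rayleigh.
Variable C : numClosedFieldType.
Local Open Scope sesquilinear_scope.

(** In an orthonormal eigenbasis the Rayleigh quotient of [u] is a mean of
    eigenvalues, weighted by the squared coordinates of [u].  So one of the
    eigenvalues with a nonzero coordinate is at most the quotient. *)
Lemma rayleigh_eigenvector n (A : 'M[C]_n) (u : 'rV_n) d :
    A \is hermsymmx -> d \is Num.real -> u != 0 ->
    (u *m A *m u ^t*) 0 0 <= d * (u *m u ^t*) 0 0 ->
  exists (v : 'rV_n) (r : C), [/\ r \is Num.real, r <= d, v *m A = r *: v &
    u *m v ^t* != 0].
Proof.
move=> hA dR u0 ray.
set P := spectralmx A; set s := spectral_diag A.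
have unP : P \is unitarymx := spectral_unitarymx A.
have sR k : s 0 k \is Num.real.
  by have /mxOverP := hermitian_spectral_diag_real hA; apply.
have AE : A = P ^t* *m diag_mx s *m P.
  by rewrite -invmx_unitary //; apply/orthomx_spectralP/hermitian_normalmx.
pose w := u *m P ^t*.
have wE k : u *m (row k P) ^t* = (w 0 k)%:M.
  apply/matrixP => a b; rewrite !ord1 !mxE mulr1n.
  by apply: eq_bigr => l _; rewrite !mxE.
have uE : u = w *m P.
  by rewrite /w -mulmxA -invmx_unitary // mulVmx ?spectral_unit ?mulmx1.
have norm_u : (u *m u ^t*) 0 0 = \sum_k w 0 k * (w 0 k)^*.
  rewrite {2}uE trmx_mul map_mxM mulmxA -/w mxE.
  by apply: eq_bigr => k _; rewrite !mxE.
have form_u : (u *m A *m u ^t*) 0 0 = \sum_k s 0 k * (w 0 k * (w 0 k)^*).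
  have -> : u *m A *m u ^t* = w *m diag_mx s *m w ^t*.
    rewrite AE !mulmxA -/w -mulmxA; congr (_ *m _).
    by rewrite /w trmx_mul map_mxM; congr (_ *m _); rewrite trmxCK.
  rewrite mxE; apply: eq_bigr => k _; rewrite mul_mx_diag !mxE mulrA.
  by rewrite [s 0 k * _]mulrC.
have [k0 wk0] : exists k, w 0 k != 0.
  by apply/rV0Pn; apply: contraNneq u0 => w0; rewrite uE w0 mul0mx.
have [k /andP[wk sk]] : exists k, (w 0 k != 0) && (s 0 k <= d).
  apply/existsP; apply: contraT; rewrite negb_exists => /forallP large.
  have gt_d k : w 0 k != 0 -> d < s 0 k.
    by have := large k; case: eqP => //= _; rewrite real_ltNge.
  have : \sum_k (s 0 k - d) * (w 0 k * (w 0 k)^*) <= 0.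
    rewrite (eq_bigr (fun k => s 0 k * (w 0 k * (w 0 k)^*) -
        d * (w 0 k * (w 0 k)^*))) => [|k _]; last by rewrite mulrBl.
    by rewrite sumrB -form_u -mulr_sumr -norm_u subr_le0.
  rewrite lt_geF // (bigD1 k0) //= ltr_wpDr //.
    apply: sumr_ge0 => k _; have [->|wk] := eqVneq (w 0 k) 0.
      by rewrite mul0r mulr0.
    by rewrite mulr_ge0 ?mul_conjC_ge0 // subr_ge0 ltW ?gt_d.
  by rewrite mulr_gt0 ?mul_conjC_gt0 // subr_gt0 gt_d.
exists (row k P), (s 0 k); split=> //.
  rewrite AE -!row_mul !mulmxA -invmx_unitary // mulmxV ?spectral_unit // mul1mx.
  by apply/rowP => j; rewrite mxE mul_diag_mx !mxE.
by rewrite wE; apply: contraNneq wk => /matrixP /(_ 0 0) /eqP; rewrite !mxE mulr1n.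
Qed.

(** Subtract from the eigenvector [v] given by the Rayleigh quotient its mean
    value.  It stays nonzero, because [u] is orthogonal to constants but not to
    [v]; it stays an eigenvector, because constants are in the kernel of [A] and
    a nonzero mean is only possible when [r = 0]. *)
Lemma zero_sum_eigenvector n (A : 'M[C]_n) (u : 'rV_n) d :
    A \is hermsymmx -> const_mx 1 *m A = 0 :> 'rV_n ->
    d \is Num.real -> u != 0 -> \sum_k u 0 k = 0 ->
    (u *m A *m u ^t*) 0 0 <= d * (u *m u ^t*) 0 0 ->
  exists (v : 'rV_n) (r : C), [/\ r \is Num.real, r <= d, v *m A = r *: v, v != 0 &
    \sum_k v 0 k = 0].
Proof.
move=> hA A1 dR u0 su ray.
have [v [r [rR rd vE uv]]] := rayleigh_eigenvector hA dR u0 ray.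
have n0 : n%:R != 0 :> C.
  rewrite pnatr_eq0; apply: contraNneq u0; clear.
  by case: n u => // u _; rewrite [u]thinmx0.
pose m := (\sum_k v 0 k) / n%:R.
(* The rows of [A] have sum zero by hermitian symmetry. *)
have rm : r * m = 0.
  have A1t : A *m (const_mx 1 : 'cV_n) = 0.
    have /is_hermitianmxP -> := hA; rewrite expr0 scale1r.
    rewrite -[const_mx 1]trmxK trmx_const.
    have -> : const_mx 1 = (const_mx 1 : 'rV[C]_n) ^ Num.conj.
      by apply/matrixP => a b; rewrite !mxE rmorph1.
    by rewrite map_trmx -map_mxM -trmx_mul A1 trmx0 map_mx0.
  rewrite /m mulrA; apply/eqP; rewrite mulf_eq0; apply/orP; left; apply/eqP.
  have : (v *m A *m (const_mx 1 : 'cV_n)) 0 0 = 0 by rewrite -mulmxA A1t mulmx0 mxE.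
  rewrite vE -scalemxAl !mxE => h; rewrite -[RHS]h; congr (_ * _).
  by apply: eq_bigr => k _; rewrite !mxE mulr1.
exists (v - m *: const_mx 1), r; split=> //.
- by rewrite mulmxBl -scalemxAl A1 scaler0 subr0 vE scalerBr scalerA rm scale0r subr0.
- apply: contraNneq uv => /subr0_eq ->; apply/eqP/matrixP => a b; rewrite !ord1 !mxE.
  rewrite (eq_bigr (fun k => u 0 k * m^*)) => [|k _]; last by rewrite !mxE mulr1.
  by rewrite -mulr_suml su mul0r.
- rewrite (eq_bigr (fun k => v 0 k - m)) => [|k _]; last by rewrite !mxE mulr1.
  by rewrite sumrB sumr_const card_ord -[m *+ n]mulr_natr /m divfK ?subrr.
Qed.

End Rayleigh.

(** * The natural permutation representation of the symmetric group *)

Section Symmetric.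
Variable n : nat.
Implicit Types B : {set 'I_n}.

Lemma symg_subP B (s : symg n) :
  reflect (forall i, i \notin B -> s i = i) (s \in symg_sub B).
Proof.
rewrite inE; apply: (iffP forallP) => h i; last by apply/implyP=> /h ->.
by move/implyP: (h i) => h' /h' /eqP.
Qed.

Lemma symg_sub_group_set B : group_set (symg_sub B).
Proof.
apply/group_setP; split=> [|s t /symg_subP hs /symg_subP ht].
  by apply/symg_subP => i _; rewrite perm1.
by apply/symg_subP => i nB; rewrite symgME ht ?hs.
Qed.

Canonical symg_sub_group B := Group (symg_sub_group_set B).

Lemma symgVK (s : symg n) i : (s^-1)%g (s i) = i.
Proof. by rewrite -symgME mulVg perm1. Qed.

Lemma symgKV (s : symg n) i : s ((s^-1)%g i) = i.
Proof. by rewrite -symgME mulgV perm1. Qed.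

Variable C : numClosedFieldType.

(** Sort the permutations by the image [k] of [i]: for each of the [n] values of
    [k], those that occur form a coset of the stabiliser of [i], or none occur. *)
Lemma symg_sub_fixing_ge B i :
  (#|symg_sub B|%:R : C) <= n%:R * \sum_(x in symg_sub B) (x i == i)%:R.
Proof.
have -> : #|symg_sub B|%:R = \sum_k \sum_(x in symg_sub B) (x i == k)%:R :> C.
  rewrite exchange_big /= -sum1_card natr_sum; apply: eq_bigr => x _.
  by rewrite (bigD1 (x i)) //= eqxx big1 ?addr0 // => k /negPf; rewrite eq_sym => ->.
rewrite mulr_natl -[X in _ *+ X]card_ord -sumr_const; apply: ler_sum => k _.
have [[y By yk]|nx] := pselect (exists2 y : symg n, y \in symg_sub B & y i = k).
  rewrite le_eqVlt; apply/orP; left; apply/eqP.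
  rewrite (reindex_inj (mulgI y)) /=; apply: eq_big => [x|x _].
    by rewrite groupMl.
  by rewrite -yk permM (inj_eq perm_inj).
rewrite big1 ?sumr_ge0 // => x Bx; case: eqP => // xk.
by case: nx; exists x.
Qed.

Variable c : {set 'I_n} -> C.

(** The Laplacian of the permutation representation on [{0, .., n-1}].  It is a
    part of the regular one: [f] corresponds to the function [s |-> f (s i)], for
    a fixed base point [i]. *)
Definition perm_laplacian_mx : 'M[C]_n :=
  \matrix_(l, k) \sum_B c B *
    ((l == k)%:R - #|symg_sub B|%:R^-1 * \sum_(x in symg_sub B) (x k == l)%:R).

Lemma mul_perm_laplacian_mx (f : 'rV_n) k :
  (f *m perm_laplacian_mx) 0 k =
  \sum_B c B * (f 0 k - #|symg_sub B|%:R^-1 * \sum_(x in symg_sub B) f 0 (x k)).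
Proof.
rewrite mxE.
under eq_bigr do rewrite mxE mulr_sumr.
rewrite exchange_big; apply: eq_bigr => B _ /=.
under eq_bigr do rewrite mulrCA mulrBr mulrCA.
rewrite -mulr_sumr sumrB; congr (_ * (_ - _)).
  rewrite (bigD1 k) //= eqxx mulr1 big1 ?addr0 // => l /negPf ->.
  by rewrite mulr0.
rewrite -mulr_sumr; congr (_ * _).
under [LHS]eq_bigr do rewrite mulr_sumr.
rewrite exchange_big; apply: eq_bigr => x _ /=.
rewrite (bigD1 (x k)) //= eqxx mulr1 big1 ?addr0 // => l /negPf.
by rewrite eq_sym => ->; rewrite mulr0.
Qed.

Hypothesis c_ge0 : forall B, 0 <= c B.

Lemma perm_laplacian_mx_herm : perm_laplacian_mx \is hermsymmx.
Proof.
apply: realsym_hermsym.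
  apply/is_hermitianmxP; rewrite expr0 scale1r; apply/matrixP => l k.
  rewrite !mxE; apply: eq_bigr => B _; rewrite eq_sym; congr (_ * (_ - _ * _)).
  rewrite (reindex_inj invg_inj) /=; apply: eq_big => [x|x _]; first by rewrite groupV.
  by congr (nat_of_bool _)%:R; apply/eqP/eqP => [<-|<-]; rewrite ?symgKV ?symgVK.
apply/mxOverP => l k; rewrite mxE rpred_sum // => B _.
apply: rpredM; first exact: ger0_real.
rewrite rpredB ?rpredM ?rpredV ?rpred_nat ?rpred_sum // => x _.
exact: rpred_nat.
Qed.

Lemma const_mul_perm_laplacian_mx : const_mx 1 *m perm_laplacian_mx = 0 :> 'rV_n.
Proof.
apply/rowP => k; rewrite mul_perm_laplacian_mx [RHS]mxE big1 // => B _.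
rewrite mxE (eq_bigr (fun=> 1)) => [|x _]; last by rewrite mxE.
by rewrite sumr_const mulVf ?subrr ?mulr0 // pnatr_eq0 -lt0n cardG_gt0.
Qed.

Lemma sum_mul_perm_laplacian_mx (f : 'rV_n) :
  \sum_k (f *m perm_laplacian_mx) 0 k = 0.
Proof.
under eq_bigr do rewrite mul_perm_laplacian_mx.
rewrite exchange_big big1 // => B _ /=.
rewrite -mulr_sumr sumrB -mulr_sumr exchange_big /=.
rewrite [X in _ - _ * X](eq_bigr (fun=> \sum_k f 0 k)) => [|x _]; last first.
  by rewrite [RHS](reindex_inj (@perm_inj _ x)).
rewrite sumr_const -[(\sum_k _) *+ _]mulr_natl mulKf ?subrr ?mulr0 //.
by rewrite pnatr_eq0 -lt0n cardG_gt0.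
Qed.

(** The test vector is [u], the indicator of [i] made orthogonal to constants.
    Then [<u, u>] and [<u, L u>] are diagonal coefficients at [i], namely
    [1 - 1/n] and the sum over the [B] containing [i] of [c_B] times one minus
    the proportion of permutations of [B] that fix [i]; this proportion is at
    least [1/n]. *)
Lemma symg_small_eigenvalue (i : 'I_n) : (2 <= n)%N ->
  exists (F : symg n -> C) r, [/\ r \is Num.real,
    r <= \sum_(B : {set 'I_n} | i \in B) c B &
    zero_sum_eigenfunction (@symg_sub n) c r F].
Proof.
move=> n2; set d := \sum_(B | _) _.
have n0 : n%:R != 0 :> C by rewrite pnatr_eq0 -lt0n (ltn_trans _ n2).
have d0 : 0 <= d by apply: sumr_ge0.
pose L := perm_laplacian_mx.
pose e : 'rV[C]_n := delta_mx 0 i.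
pose u : 'rV[C]_n := e - n%:R^-1 *: const_mx 1.
have uL : u *m L = e *m L.
  by rewrite mulmxBl -scalemxAl const_mul_perm_laplacian_mx scaler0 subr0.
have uk k : u 0 k = (k == i)%:R - n%:R^-1 by rewrite !mxE eqxx mulr1.
have sum_u : \sum_k u 0 k = 0.
  under eq_bigr do rewrite uk.
  rewrite sumrB sumr_const card_ord -[_^-1 *+ n]mulr_natr mulVf //.
  by rewrite (bigD1 i) //= eqxx big1 ?addr0 ?subrr // => k /negPf ->.
have dot_u (w : 'rV[C]_n) : \sum_k w 0 k = 0 -> (w *m map_mx Num.conj u^T) 0 0 = w 0 i.
  move=> sw; rewrite mxE -[RHS]subr0 -[X in _ = _ - X](mulr0 n%:R^-1).
  rewrite -[X in _ = _ - _ * X]sw mulr_sumr.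
  have -> : w 0 i = \sum_k w 0 k * (k == i)%:R.
    by rewrite (bigD1 i) //= eqxx mulr1 big1 ?addr0 // => k /negPf ->; rewrite mulr0.
  rewrite -sumrB; apply: eq_bigr => k _.
  rewrite mxE [u^T _ _]mxE uk rmorphB rmorphV ?unitfE // !rmorph_nat.
  by rewrite mulrBr [_ * w _ _]mulrC.
have ui : u 0 i = 1 - n%:R^-1 by rewrite uk eqxx.
have ui0 : 0 < u 0 i.
  by rewrite ui subr_gt0 invf_lt1 ?ltr0n ?ltr1n // (ltn_trans _ n2).
have u0 : u != 0 by apply: contraTneq ui0 => ->; rewrite mxE ltxx.
have ray : (u *m L *m map_mx Num.conj u^T) 0 0 <= d * (u *m map_mx Num.conj u^T) 0 0.
  rewrite (dot_u u) // (dot_u (u *m L)); last exact: sum_mul_perm_laplacian_mx.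
  rewrite uL mul_perm_laplacian_mx (bigID (fun B => i \in B)) /=.
  rewrite [X in _ + X]big1 ?addr0 => [|B iB]; last first.
    rewrite (eq_bigr (fun=> 1)) => [|x /symg_subP xB]; last by rewrite xB // mxE !eqxx.
    rewrite mxE !eqxx sumr_const mulVf ?subrr ?mulr0 //.
    by rewrite pnatr_eq0 -lt0n cardG_gt0.
  rewrite mulr_suml; apply: ler_sum => B iB; apply: ler_wpM2l => //.
  rewrite ui mxE !eqxx lerD2l lerN2.
  have S0 : 0 < #|symg_sub B|%:R :> C by rewrite ltr0n cardG_gt0.
  rewrite -[leLHS]mul1r ler_pdivrMr ?ltr0n ?(ltn_trans _ n2) // -mulrA.
  rewrite ler_pdivlMl // mulr1 mulrC.
  apply: le_trans (symg_sub_fixing_ge B i) _; rewrite le_eqVlt; apply/orP; left.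
  apply/eqP; congr (_ * _); apply: eq_bigr => x _.
  by rewrite mxE eqxx.
have [v [r [rR rd vE v0 sv]]] := zero_sum_eigenvector perm_laplacian_mx_herm
  const_mul_perm_laplacian_mx (ger0_real d0) u0 sum_u ray.
exists (fun s : symg n => v 0 (s i)), r; split=> //; split.
- have /rV0Pn [k vk] := v0; exists (Symg (tperm i k)).
  by rewrite /= tpermL.
- apply: (mulfI n0); rewrite mulr0 mulr_natl -[X in _ *+ X]card_ord -sumr_const.
  (* The sum over the group does not depend on the base point. *)
  transitivity (\sum_(k < n) \sum_(s : symg n) v 0 (s k)).
    apply: eq_bigr => k _; rewrite (reindex_inj (mulIg (Symg (tperm i k)))) /=.
    by apply: eq_bigr => s _; rewrite permM /= tpermL.
  rewrite exchange_big big1 // => s _ /=.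
  by rewrite -[RHS]sv [RHS](reindex_inj (@perm_inj _ s)).
- move=> s; transitivity ((v *m L) 0 (s i)); last by rewrite vE mxE.
  rewrite mul_perm_laplacian_mx; apply: eq_bigr => B _.
  by congr (_ * (_ - _ * _)); apply: eq_bigr => x _; rewrite permM.
Qed.

End Symmetric.

(** * The wreath product *)

Section Wreath.
Variables (n : nat) (gT : finGroupType).
Implicit Types (B : {set 'I_n}) (w x y : wreath n gT) (g h : {ffun 'I_n -> gT}).

Lemma wreath_subP B w :
  reflect (forall i, i \notin B -> wperm w i = i /\ wbase w i = 1%g)
          (w \in wreath_sub gT B).
Proof.
rewrite inE; apply: (iffP andP) => [[/symg_subP hs /forallP hb] i nB|h].
  by split; [apply: hs | have /implyP/(_ nB)/eqP := hb i].
split; first by apply/symg_subP => i /h[].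
by apply/forallP => i; apply/implyP => /h[_ ->].
Qed.

Lemma wreath_sub_group_set B : group_set (wreath_sub gT B).
Proof.
apply/group_setP; split=> [|v w /wreath_subP hv /wreath_subP hw].
  by apply/wreath_subP => i _; rewrite perm1 ffunE.
apply/wreath_subP => i nB; have [vi vb] := hv i nB; have [wi wb] := hw i nB.
split; first by rewrite symgME wi vi.
by rewrite ffunE vb mul1g -{1}vi symgVK.
Qed.

Canonical wreath_sub_group B := Group (wreath_sub_group_set B).

Lemma wreath_sub_sub (A B : {set 'I_n}) :
  A \subset B -> wreath_sub gT A \subset wreath_sub gT B.
Proof.
move=> /fintype.subsetP sAB; apply/fintype.subsetP => w /wreath_subP hw.
by apply/wreath_subP => i nB; apply: hw; apply: contra nB; apply: sAB.
Qed.

Lemma wreath_sub1_wperm i w : w \in wreath_sub gT [set i]%SET -> wperm w = 1%g.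
Proof.
move=> /wreath_subP hw; apply: val_inj; apply/permP => k; rewrite perm1.
have fixk j : j != i -> wperm w j = j by move=> ji; case: (hw j); rewrite // inE.
have [->|/fixk //] := eqVneq k i.
apply/eqP; apply: contraT => wi.
by have /perm_inj/eqP := fixk _ wi; rewrite (negPf wi).
Qed.

Lemma wreath_sub1_commute i B : i \notin B ->
  {in wreath_sub gT [set i]%SET & wreath_sub gT B, commutative (@mulg (wreath n gT))}.
Proof.
move=> iB x y xi /wreath_subP yB; have x1 := wreath_sub1_wperm xi.
have /wreath_subP xb := xi.
rewrite /mulg /= /wreath_mul x1 mul1g mulg1; congr Wreath; apply/ffunP => k.
rewrite !ffunE invg1 perm1.
have [yi yb] := yB i iB; have [->|ki] := eqVneq k i.
  by rewrite yb mul1g mulg1 -{2}yi symgVK.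
have -> : wbase x k = 1%g by case: (xb k); rewrite // inE.
case: (xb ((wperm y)^-1%g k)) => [|_ ->]; last by rewrite mul1g mulg1.
by rewrite inE; apply: contra ki => /eqP yk; rewrite -yi -yk symgKV.
Qed.

Variable C : numClosedFieldType.
Implicit Types F : wreath n gT -> C.

(** Averaging over one copy of [G] commutes with all the terms of the Laplacian:
    this copy is contained in the subgroup of [B] if [i] lies in [B], and
    centralises it otherwise. *)
Lemma avg_wreath_sub1_comm i B F :
  avg (wreath_sub gT [set i]%SET) (avg (wreath_sub gT B) F) =
  avg (wreath_sub gT B) (avg (wreath_sub gT [set i]%SET) F).
Proof.
have [iB|iB] := boolP (i \in B).
  have sub : wreath_sub gT [set i]%SET \subset wreath_sub gT B.
    by rewrite wreath_sub_sub // finset.sub1set.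
  by rewrite avg_absorbl ?avg_absorbr.
by apply: avg_comm; apply: wreath_sub1_commute.
Qed.

(** Left translations by the [i]-th copy of [G] change the [i]-th base coordinate
    arbitrarily, so all of them can be reset to [1] one at a time. *)
Lemma avg_wreath_sub1_invariant F :
    (forall i, avg (wreath_sub gT [set i]%SET) F = F) ->
  F = fun w => F (Wreath [ffun=> 1%g] (wperm w)).
Proof.
move=> invF.
suff indep (s : seq 'I_n) g h t : (forall k, k \notin s -> g k = h k) ->
    F (Wreath g t) = F (Wreath h t).
  apply/funext => -[g t] /=; apply: (indep (enum 'I_n)) => k.
  by rewrite mem_enum inE.
elim: s g => [|i s IHs] g gh.
  by congr (F (Wreath _ _)); apply/ffunP => k; apply: gh.
pose x : wreath n gT :=
  Wreath [ffun k => if k == i then (h i * (g i)^-1)%g else 1%g] 1%g.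
have xi : x \in wreath_sub gT [set i]%SET.
  apply/wreath_subP => k; rewrite inE => /negPf ki.
  by rewrite perm1 ffunE ki.
have -> : F (Wreath g t) = F (x * Wreath g t)%g.
  by rewrite -(invF i) avg_translate.
rewrite {1}/mulg /= /wreath_mul /= mul1g; apply: IHs => k ks.
rewrite !ffunE invg1 perm1; have [->|ki] := eqVneq k i; first by rewrite mulgKV.
by rewrite mul1g gh // inE negb_or ki.
Qed.

(** The fibres of the projection of the subgroup of [B] onto its permutations all
    have the same size, that of [G ^ B]. *)
Lemma sum_wreath_sub B : exists2 N : nat, (0 < N)%N & forall f : symg n -> C,
  \sum_(x in wreath_sub gT B) f (wperm x) = N%:R * \sum_(s in symg_sub B) f s.
Proof.
pose base := [set g : {ffun 'I_n -> gT} | [forall i, (i \notin B) ==> (g i == 1%g)]]%SET.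
exists #|base|.
  apply/card_gt0P; exists [ffun=> 1%g]; rewrite inE; apply/forallP => i.
  by rewrite ffunE eqxx implybT.
move=> f; rewrite (reindex_onto (@wreath_of_pair n gT) (@pair_of_wreath n gT)) /=; last first.
  by move=> w _; apply: pair_of_wreathK.
rewrite mulr_natl -sumr_const pair_big /=; apply: eq_bigl => -[g s].
by rewrite eqxx andbT /= !inE andbC.
Qed.
End Wreath.

Section Lift.
Variables (n : nat) (gT : finGroupType) (C : numClosedFieldType).
Variable c : {set 'I_n} -> C.
Implicit Types f : symg n -> C.

Lemma avg_wreath_sub_wperm B f (w : wreath n gT) :
  avg (wreath_sub gT B) (fun x => f (wperm x)) w = avg (symg_sub B) f (wperm w).
Proof.
have [N N0 sumE] := sum_wreath_sub gT C B.
have cardE : #|wreath_sub gT B|%:R = N%:R * #|symg_sub B|%:R :> C.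
  by rewrite -!sum1_card !natr_sum (sumE (fun=> 1)).
rewrite /avg cardE (sumE (fun s => f (s * wperm w)%g)) invfM mulrACA.
by rewrite mulVf ?mul1r // pnatr_eq0 -lt0n.
Qed.

(** The projection of the wreath product onto the symmetric group carries the
    uniform distribution on each subgroup of [B] to the uniform one, so pulling
    back intertwines the Laplacians. *)
Lemma zero_sum_eigenfunction_wperm r f :
  zero_sum_eigenfunction (wreath_sub gT) c r (fun w => f (wperm w)) <->
  zero_sum_eigenfunction (@symg_sub n) c r f.
Proof.
have lapE (w : wreath n gT) :
    lap (wreath_sub gT) c (fun x => f (wperm x)) w = lap (@symg_sub n) c f (wperm w).
  by apply: eq_bigr => B _; rewrite avg_wreath_sub_wperm.
have sum0 : \sum_(w : wreath n gT) f (wperm w) = 0 <-> \sum_s f s = 0.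
  have [N N0 sumE] := sum_wreath_sub gT C [set: 'I_n]%SET.
  have inW (w : wreath n gT) : w \in wreath_sub gT [set: 'I_n]%SET.
    by apply/wreath_subP => i; rewrite inE.
  have inS (s : symg n) : s \in symg_sub [set: 'I_n]%SET.
    by apply/symg_subP => i; rewrite inE.
  have := sumE f; rewrite (eq_bigl _ _ inW) (eq_bigl _ _ inS) => ->.
  split=> [/eqP|->]; last by rewrite mulr0.
  by rewrite mulf_eq0 pnatr_eq0 -leqn0 leqNgt N0 => /eqP.
pose lift s : wreath n gT := Wreath [ffun=> 1%g] s.
split=> -[[a fa] /sum0 s0 fE]; split=> //.
- by exists (wperm a).
- by move=> s; have := fE (lift s); rewrite lapE.
- by exists (lift a).
- by move=> w; rewrite lapE.
Qed.

Hypothesis c_ge0 : forall B, 0 <= c B.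

(** Averaging over the copies of [G] one after the other either annihilates the
    eigenfunction at some step, and then the terms with [i] in [B] contribute
    their full weight, or ends with an eigenfunction that is invariant under all
    of [G ^ n] and so comes from the symmetric group. *)
Lemma wreath_eigenvalue_dichotomy r F :
  zero_sum_eigenfunction (wreath_sub gT) c r F ->
  (exists i : 'I_n, \sum_(B : {set 'I_n} | i \in B) c B <= r) \/
  (exists f, zero_sum_eigenfunction (@symg_sub n) c r f).
Proof.
move=> eF; pose P (i : 'I_n) := avg (C := C) (wreath_sub gT [set i]%SET).
have P_absorb i (B : {set 'I_n}) F' : i \in B ->
    avg (wreath_sub gT B) (P i F') = avg (wreath_sub gT B) F'.
  by move=> iB; rewrite avg_absorbr // wreath_sub_sub // finset.sub1set.
have steps (s : seq 'I_n) : (exists i : 'I_n, \sum_(B : {set 'I_n} | i \in B) c B <= r) \/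
    exists2 F', zero_sum_eigenfunction (wreath_sub gT) c r F' &
      forall i, i \in s -> P i F' = F'.
  elim: s => [|i s [|[F' eF' invF']]]; first by right; exists F.
    by left.
  have [nz|z] := pselect (exists w, P i F' w != 0).
    right; exists (P i F').
      by apply: zero_sum_eigenfunction_avg => // B; apply: avg_wreath_sub1_comm.
    move=> j; rewrite inE => /orP[/eqP->|js]; first exact: avg_absorbl.
    by rewrite /P avg_wreath_sub1_comm -/(P j F') invF'.
  left; exists i; apply: (eigenvalue_ge_killed (H := wreath_sub_group gT)
    (S := fun B => i \in B) c_ge0 _ eF').
  move=> B iB; rewrite -(P_absorb i) //.
  have -> : P i F' = fun=> 0.
    by apply/funext => w; apply/eqP; apply: contra_notT z => nz; exists w.
  exact: avg0.
have [|[F' eF' invF']] := steps (enum 'I_n); first by left.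
right; exists (fun t => F' (Wreath [ffun=> 1%g] t)).
apply/zero_sum_eigenfunction_wperm; rewrite -avg_wreath_sub1_invariant // => i.
by rewrite -/(P i F') invF' // mem_enum.
Qed.

End Lift.

Theorem theorem1p6 (R : realType) (n : nat) (gT : finGroupType)
    (c : {set 'I_n} -> R) (hn : (2 <= n)%N)
    (hc : forall B : {set 'I_n}, (0 <= c B)%R) :
  lambda_min_star (wreath_laplacian c gT) (left_regular R (wreath n gT)) =
  lambda_min_star (laplacian c) (left_regular R (symg n)).
Proof.
have cC_ge0 (B : {set 'I_n}) : (0 : R[i]) <= ((c B)%:C)%C by rewrite lecR.
rewrite (lambda_min_star_regularE (@symg_sub n) c).
rewrite (lambda_min_star_regularE (wreath_sub gT) c).
apply: le_anti; apply/andP; split; apply: le_ereal_inf_tmp => _ [r [F eF] <-].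
  apply: ereal_inf_lbound; exists r => //=.
  by exists (fun w => F (wperm w)); apply/zero_sum_eigenfunction_wperm.
have [[i ir]|[f ef]] := wreath_eigenvalue_dichotomy cC_ge0 eF; last first.
  by apply: ereal_inf_lbound; exists r => //=; exists f.
have [f [q [/complex_realP [q' ->] qd ef]]] := symg_small_eigenvalue cC_ge0 i hn.
apply: (@le_trans _ _ q'%:E).
  by apply: ereal_inf_lbound; exists q' => //=; exists f.
by rewrite lee_fin -lecR (le_trans qd).
Qed.
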